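(* Let $n\ge 1$, let $\boldsymbol{a},\boldsymbol{b}\in\mathbb{R}^n$ with $a_j<b_j$ for all $j$, and let $\{f_i\}_{i=1}^\infty$ be a sequence of jointly monotone increasing real-valued functions on the rectangle $[\boldsymbol{a},\boldsymbol{b}]=\prod_{j=1}^n[a_j,b_j]$. Suppose that for every $\boldsymbol{x}\in[\boldsymbol{a},\boldsymbol{b}]$ the series $\sum_{i=1}^\infty f_i(\boldsymbol{x})$ converges. Then $$\Big(\sum_{i=1}^\infty f_i\Big)^{(n)}(\boldsymbol{x})=\sum_{i=1}^\infty f_i^{(n)}(\boldsymbol{x})\quad\text{for almost every }\boldsymbol{x}\in[\boldsymbol{a},\boldsymbol{b}].$$
   Context: For $\boldsymbol{c},\boldsymbol{d}\in\mathbb{R}^n$, $\boldsymbol{c}\le\boldsymbol{d}$ means $c_j\le d_j$ for all $j$, and $[\boldsymbol{c},\boldsymbol{d}]=\prod_j[c_j,d_j]$. The joint increment of a function $f$ over $[\boldsymbol{c},\boldsymbol{d}]$ is $$\Delta_f^n[\boldsymbol{c},\boldsymbol{d}]=\sum_{\epsilon_1,\dots,\epsilon_n\in\{0,1\}}(-1)^{n+\epsilon_1+\dots+\epsilon_n}f\big(c_1+\epsilon_1(d_1-c_1),\dots,c_n+\epsilon_n(d_n-c_n)\big).$$ $f$ is jointly monotone increasing on $[\boldsymbol{a},\boldsymbol{b}]$ if $\Delta_f^n[\boldsymbol{x},\boldsymbol{y}]\ge 0$ for all $\boldsymbol{x}\le\boldsymbol{y}$ in $[\boldsymbol{a},\boldsymbol{b}]$.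 The joint derivative of $f$ at a point $\boldsymbol{x}$ in a neighborhood of which $f$ is defined is $$f^{(n)}(\boldsymbol{x})=\lim_{h\to0^+}\frac{\Delta_f^n\big([x_1,x_1+h]\times\dots\times[x_n,x_n+h]\big)}{h^n},$$ when the limit exists (as a finite real number). The asserted identity is understood to include the existence of all the joint derivatives involved and convergence of the series on the right, for almost every $\boldsymbol{x}$. *)

(* Defs.v *)
From HB Require Import structures.
From mathcomp Require Import all_boot all_order all_algebra.
From mathcomp Require Import all_classical all_reals all_analysis.

Set Implicit Arguments.
Unset Strict Implicit.
Unset Printing Implicit Defensive.

Import Order.TTheory GRing.Theory Num.Theory.
Import numFieldNormedType.Exports.

Local Open Scope classical_set_scope.
Local Open Scope ring_scope.

Definition le_vec (R : realType) (n : nat) (c d : 'rV[R]_n) : Prop :=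
  forall j : 'I_n, c 0 j <= d 0 j.

Definition box (R : realType) (n : nat) (c d : 'rV[R]_n) : set 'rV[R]_n :=
  [set x | le_vec c x /\ le_vec x d].

Definition joint_increment (R : realType) (n : nat) (f : 'rV[R]_n -> R)
    (c d : 'rV[R]_n) : R :=
  \sum_(eps : {ffun 'I_n -> bool})
    (-1) ^+ (n + \sum_(j < n) eps j)%N *
    f (\row_j (c 0 j + (eps j)%:R * (d 0 j - c 0 j))).

(* Functions on [a, b] are represented by total functions; only their values
   on [a, b] are constrained. *)
Definition jointly_monotone (R : realType) (n : nat) (a b : 'rV[R]_n)
    (f : 'rV[R]_n -> R) : Prop :=
  forall x y : 'rV[R]_n, box a b x -> box a b y -> le_vec x y ->
    0 <= joint_increment f x y.

Definition joint_quotient (R : realType) (n : nat) (f : 'rV[R]_n -> R)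
    (x : 'rV[R]_n) (h : R) : R :=
  joint_increment f x (x + const_mx h) / h ^+ n.

(* D is the domain on which f is meaningful: the joint derivative is only
   considered at interior points of D, so that the values of the total function
   f outside D play no role. *)
Definition joint_derivable (R : realType) (n : nat) (D : set 'rV[R]_n)
    (f : 'rV[R]_n -> R) (x : 'rV[R]_n) : Prop :=
  interior D x /\ cvg (joint_quotient f x h @[h --> 0^'+]).

Definition joint_derivative (R : realType) (n : nat) (f : 'rV[R]_n -> R)
    (x : 'rV[R]_n) : R :=
  lim (joint_quotient f x h @[h --> 0^'+]).

Definition box_volume (R : realType) (n : nat) (c d : 'rV[R]_n) : R :=
  \prod_(j < n) (d 0 j - c 0 j).

(* n-dimensional Lebesgue outer measure: infimum of the total volumes of the
   countable covers by closed boxes. *)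
Definition lebesgue_outer_measure (R : realType) (n : nat)
    (X : set 'rV[R]_n) : \bar R :=
  ereal_inf [set (\sum_(0 <= k <oo) (box_volume (C k).1 (C k).2)%:E)%E |
    C in [set C : nat -> 'rV[R]_n * 'rV[R]_n |
      (forall k, le_vec (C k).1 (C k).2) /\
      X `<=` \bigcup_k box (C k).1 (C k).2]].

(* Lebesgue-null sets are exactly the sets of zero outer measure. *)
Definition ae_in (R : realType) (n : nat) (D : set 'rV[R]_n)
    (P : 'rV[R]_n -> Prop) : Prop :=
  lebesgue_outer_measure (D `&` [set x | ~ P x]) = 0%E.

Definition sum_fun (R : realType) (n : nat) (f : nat -> 'rV[R]_n -> R)
    (x : 'rV[R]_n) : R :=
  limn (series (fun i => f i x)).

(* Main.v *)
(* The joint increment of f over [c, d] is additive when a box is cut by a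
   coordinate hyperplane, so joint monotonicity makes it a nonnegative additive
   function F of boxes, to which Lebesgue's argument applies. A Vitali covering
   by cubes [x, x + h) gives the weak-type bound: the points where
   F[x, x + h] >= q h^n for arbitrarily small h have outer measure at most
   F[a, b] / q. Two nested Vitali coverings show that the points where the lower
   derivative is < p and the upper one > q, with p < q, form a null set; hence F
   has a finite derivative almost everywhere. For a series, the tails
   R_N = F - (F_0 + ... + F_{N-1}) are again nonnegative and additive and
   R_N[a, b] tends to 0, so by the weak-type bound the derivatives of R_N tend
   to 0 almost everywhere.

   Half-open boxes are used throughout: a point x of [c, d) is the lower corner
   of arbitrarily small cubes [x, x + h) inside [c, d), and a point outside
   [c, d) is the lower corner of cubes avoiding it, so no boundary has to be
   discarded. *)
Require Import Defs.
From HB Require Import structures.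
From mathcomp Require Import all_boot all_order all_algebra.
From mathcomp Require Import all_classical all_reals all_analysis.
From mathcomp Require Import ring lra.
Import Order.TTheory GRing.Theory Num.Theory.
Import numFieldNormedType.Exports.
Local Open Scope classical_set_scope.
Local Open Scope ring_scope.

Set Implicit Arguments.
Unset Strict Implicit.
Unset Printing Implicit Defensive.

(** * Clamping a real number to an interval *)

Section ScalarClamp.
Variable R : realType.
Implicit Types u v x t : R.

Lemma clamp1_lb u v x : x <= u -> u <= v -> Num.max u (Num.min x v) = u.
Proof.
by move=> xu uv; rewrite (min_idPl (le_trans xu uv)) (max_idPl xu).
Qed.

Lemma clamp1_ub u v x : v <= x -> u <= v -> Num.max u (Num.min x v) = v.
Proof. by move=> vx uv; rewrite (min_idPr vx) (max_idPr uv). Qed.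

Lemma clamp1_lo u v x t : u <= t <= v -> x <= t ->
  Num.max u (Num.min x t) = Num.max u (Num.min x v).
Proof.
by case/andP=> _ tv xt; rewrite (min_idPl xt) (min_idPl (le_trans xt tv)).
Qed.

Lemma clamp1_hi u v x t : u <= t <= v -> t <= x ->
  Num.max t (Num.min x v) = Num.max u (Num.min x v).
Proof.
case/andP=> ut tv tx; have tm : t <= Num.min x v by rewrite le_min tx.
by rewrite (max_idPr tm) (max_idPr (le_trans ut tm)).
Qed.

Lemma clamp1_between u v c d t : u <= t <= v -> c <= t <= d ->
  Num.max u (Num.min c v) <= t <= Num.max u (Num.min d v).
Proof.
case/andP=> ut tv /andP[ct td].
by rewrite ge_max ut ge_min ct le_max le_min td tv orbT.
Qed.

End ScalarClamp.

(** * Additive functions of boxes and the packing inequality *)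

Section Boxes.
Variables (R : realType) (n : nat).
Implicit Types (a b c d u v x : 'rV[R]_n) (F : 'rV[R]_n -> 'rV[R]_n -> R).

Definition hbox c d : pred 'rV[R]_n :=
  fun x => [forall j, c 0 j <= x 0 j < d 0 j].

Definition upd v (j : 'I_n) (t : R) : 'rV[R]_n :=
  \row_i (if i == j then t else v 0 i).

(** Clamping both corners of a box intersects it with [u, v]; a box that misses [u, v] becomes flat
    in some coordinate. *)
Definition clamp u v x : 'rV[R]_n :=
  \row_j Num.max (u 0 j) (Num.min (x 0 j) (v 0 j)).

(** [F c d] is a value attached to the box [c, d]. Flat boxes are included, and additivity is asked
    for one hyperplane cut x_j = t at a time. *)
Definition interval_fun a b F : Prop :=
  (forall c d, le_vec a c -> le_vec c d -> le_vec d b -> 0 <= F c d) /\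
  (forall c d j t, le_vec a c -> le_vec c d -> le_vec d b ->
    c 0 j <= t <= d 0 j -> F c d = F c (upd d j t) + F (upd c j t) d).

Lemma hboxP c d x :
  reflect (forall j, c 0 j <= x 0 j < d 0 j) (hbox c d x).
Proof. exact: forallP. Qed.

Lemma le_vec_trans c d x : le_vec c d -> le_vec d x -> le_vec c x.
Proof. by move=> cd dx j; apply: le_trans (cd j) (dx j). Qed.

Lemma upd_id v j : upd v j (v 0 j) = v.
Proof. by apply/rowP => i; rewrite mxE; case: eqP => [->|]. Qed.

Lemma clamp_id u v x : le_vec u x -> le_vec x v -> clamp u v x = x.
Proof.
move=> ux xv; apply/rowP => j; rewrite mxE.
by rewrite (min_idPl (xv j)) (max_idPr (ux j)).
Qed.

Lemma le_clamp_lb u v x : le_vec u (clamp u v x).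
Proof. by move=> j; rewrite mxE le_max lexx. Qed.

Lemma le_clamp_ub u v x : le_vec u v -> le_vec (clamp u v x) v.
Proof. by move=> uv j; rewrite mxE ge_max uv ge_min lexx orbT. Qed.

Lemma le_clamp u v c d : le_vec c d -> le_vec (clamp u v c) (clamp u v d).
Proof.
by move=> cd j; rewrite !mxE; apply/le_max2/le_min2.
Qed.

(** Cutting at the common coordinate returns the same box twice, so F c d = F c d + F c d. *)
Lemma interval_fun_degenerate a b F c d j : interval_fun a b F ->
  le_vec a c -> le_vec c d -> le_vec d b -> c 0 j = d 0 j -> F c d = 0.
Proof.
move=> [_ Fadd] ac cd db e.
have := Fadd c d j (c 0 j) ac cd db; rewrite upd_id e upd_id lexx /=.
by move=> /(_ isT); lra.
Qed.

Section ClampCut.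
Variables (a b : 'rV[R]_n) (F : 'rV[R]_n -> 'rV[R]_n -> R).
Hypothesis FI : interval_fun a b F.

Lemma le_upd u v j t : le_vec u v -> u 0 j <= t <= v 0 j ->
  le_vec u (upd v j t) /\ le_vec (upd u j t) v.
Proof.
by move=> uv tj; split=> i; rewrite mxE; case: eqP => [->|]; move: (uv i); lra.
Qed.

(** If c_j < t < d_j, this is additivity for the clamped box; otherwise one piece is flat in
    coordinate j and the other is the whole clamped box. *)
Lemma interval_fun_clamp_cut u v c d j t : le_vec a u -> le_vec u v ->
  le_vec v b -> le_vec c d -> u 0 j <= t <= v 0 j ->
  F (clamp u v c) (clamp u v d) =
    F (clamp u (upd v j t) c) (clamp u (upd v j t) d) +
    F (clamp (upd u j t) v c) (clamp (upd u j t) v d).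
Proof.
move=> au uv vb cd tj.
have [uv' u'v] := le_upd uv tj.
have [[_ v'v] [uu' _]] := (le_upd uv tj, le_upd uv tj).
have v'b : le_vec (upd v j t) b.
  by move=> i; rewrite mxE; case: eqP => [->|]; move: (vb i) tj (vb j); lra.
have au' : le_vec a (upd u j t).
  by move=> i; rewrite mxE; case: eqP => [->|]; move: (au i) tj (au j); lra.
pose deg u0 v0 := @interval_fun_degenerate a b F (clamp u0 v0 c)
  (clamp u0 v0 d) j FI.
have au0 u0 v0 : le_vec a u0 -> le_vec a (clamp u0 v0 c).
  by move=> h; apply: le_vec_trans h (@le_clamp_lb _ _ _).
have v0b u0 v0 : le_vec u0 v0 -> le_vec v0 b -> le_vec (clamp u0 v0 d) b.
  by move=> h; apply: le_vec_trans (@le_clamp_ub _ _ _ h).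
have cdj := cd j; have /andP[utj tvj] := tj.
have [tc|ct] := leP t (c 0 j).
  have td := le_trans tc cdj.
  rewrite (deg u (upd v j t)) ?add0r; first last.
  - by rewrite !mxE eqxx !clamp1_ub.
  - exact: v0b.
  - exact: le_clamp.
  - exact: au0.
  congr F; apply/rowP => i; rewrite !mxE; case: eqP => // ->;
    by rewrite (clamp1_hi tj).
have [dt|td] := leP (d 0 j) t.
  rewrite (deg (upd u j t) v) ?addr0; first last.
  - by rewrite !mxE eqxx !clamp1_lb // ltW.
  - exact: v0b.
  - exact: le_clamp.
  - exact: au0.
  congr F; apply/rowP => i; rewrite !mxE; case: eqP => // ->;
    by rewrite (clamp1_lo tj) // ltW.
rewrite (proj2 FI _ _ j t); first last.
- by rewrite !mxE clamp1_between // !ltW.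
- exact: v0b.
- exact: le_clamp.
- exact: au0.
congr (F _ _ + F _ _); apply/rowP => i; rewrite !mxE; case: eqP => // ->.
- by rewrite (clamp1_lo tj) // ltW.
- by rewrite clamp1_ub // ltW.
- by rewrite clamp1_lb // ltW.
- by rewrite (clamp1_hi tj) // ltW.
Qed.

(** In each coordinate no end of [c_j, d_j] is interior to [u_j, v_j], so clamping returns all of
    [u_j, v_j] or a single point. As boxes are half-open, membership of the lower corner u tells the
    two cases apart. *)
Lemma interval_fun_clamp_whole u v c d : le_vec a u ->
  (forall j, u 0 j < v 0 j) -> le_vec v b -> le_vec c d ->
  (forall j, ~~ (u 0 j < c 0 j < v 0 j) /\ ~~ (u 0 j < d 0 j < v 0 j)) ->
  F (clamp u v c) (clamp u v d) = (hbox c d u)%:R * F u v.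
Proof.
move=> au uv vb cd nocut.
have uv' : le_vec u v by move=> j; apply: ltW.
case: hboxP => [ucd|/forallP]; rewrite ?mul1r ?mul0r.
  congr F; apply/rowP => j; rewrite mxE; have /andP[cu ud] := ucd j.
    by rewrite clamp1_lb.
  by have [_] := nocut j; rewrite ud /= -leNgt => vd; rewrite clamp1_ub.
rewrite negb_forall => /existsP[j].
rewrite negb_and -ltNge -leNgt => jP.
apply: (@interval_fun_degenerate a b F _ _ j) => //.
- exact: le_vec_trans au (@le_clamp_lb _ _ _).
- exact: le_clamp.
- exact: le_vec_trans (@le_clamp_ub _ _ _ uv') vb.
- rewrite !mxE; have [nc nd] := nocut j; case/orP: jP => [uc|du].
    have vc : v 0 j <= c 0 j by move: nc; rewrite uc /= -leNgt.
    by rewrite !clamp1_ub // (le_trans vc).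
  by rewrite !clamp1_lb // (le_trans (cd j)).
Qed.

(* Cutting [u, v] along all the faces of the boxes reduces the inequality to
   cells on which each box is either everything or negligible. *)
Lemma step_fun_clamp_ge0 (L : seq (R * ('rV[R]_n * 'rV[R]_n)))
    (S : seq ('I_n * R)) u v :
  (forall l, l \in L -> le_vec l.2.1 l.2.2) ->
  (forall x, 0 <= \sum_(l <- L) l.1 * (hbox l.2.1 l.2.2 x)%:R) ->
  le_vec a u -> le_vec u v -> le_vec v b ->
  (forall l j t, l \in L -> t = l.2.1 0 j \/ t = l.2.2 0 j ->
     u 0 j < t < v 0 j -> (j, t) \in S) ->
  0 <= \sum_(l <- L) l.1 * F (clamp u v l.2.1) (clamp u v l.2.2).
Proof.
move=> Lle Lpos; elim: S u v => [|[j t] S IH] u v au uv vb faces.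
  have [/forallP uv1|] := boolP [forall j, u 0 j < v 0 j]; last first.
    rewrite negb_forall => /existsP[j]; rewrite -leNgt => vu.
    rewrite big_seq big1 // => l lL; apply/eqP; rewrite mulf_eq0; apply/orP.
    right; apply/eqP; apply: (@interval_fun_degenerate a b F _ _ j) => //.
    - exact: le_vec_trans au (@le_clamp_lb _ _ _).
    - exact/le_clamp/Lle.
    - exact: le_vec_trans (@le_clamp_ub _ _ _ uv) vb.
    - have uvj : u 0 j = v 0 j by apply/eqP; rewrite eq_le uv vu.
      by rewrite !mxE -uvj; do 2![rewrite (max_idPl _) ?ge_min ?lexx ?orbT //].
  suff -> : \sum_(l <- L) l.1 * F (clamp u v l.2.1) (clamp u v l.2.2) =
      (\sum_(l <- L) l.1 * (hbox l.2.1 l.2.2 u)%:R) * F u v.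
    by rewrite mulr_ge0// (proj1 FI).
  rewrite mulr_suml; apply: eq_big_seq => l lL.
  rewrite interval_fun_clamp_whole ?mulrA //; first exact: Lle.
  by move=> j; split; apply/negP => /faces => /(_ l lL); rewrite in_nil;
    intuition.
have [/andP[ut tv]|tout] := boolP (u 0 j < t < v 0 j); last first.
  apply: IH => // l i s lL sl us; have := faces l i s lL sl us.
  rewrite inE => /orP[/eqP[ij st]|//]; move: tout us.
  by rewrite ij st => /negP.
have tj : u 0 j <= t <= v 0 j by rewrite !ltW.
have [uv' u'v] := le_upd uv tj.
have v'b : le_vec (upd v j t) b.
  by move=> i; rewrite mxE; case: eqP => [->|]; move: (vb i) tj (vb j); lra.
have au' : le_vec a (upd u j t).
  by move=> i; rewrite mxE; case: eqP => [->|]; move: (au i) tj (au j); lra.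
have -> : \sum_(l <- L) l.1 * F (clamp u v l.2.1) (clamp u v l.2.2) =
   \sum_(l <- L) l.1 * F (clamp u (upd v j t) l.2.1) (clamp u (upd v j t) l.2.2)
   + \sum_(l <- L)
     l.1 * F (clamp (upd u j t) v l.2.1) (clamp (upd u j t) v l.2.2).
  rewrite -big_split; apply: eq_big_seq => l lL /=.
  by rewrite (interval_fun_clamp_cut (j := j) (t := t)) ?mulrDr//; exact: Lle.
(* In both halves x_j = t is now on the boundary, so the shorter list [S] contains every face that
   still cuts them. *)
apply: addr_ge0; apply: IH => // l i s lL sl; rewrite mxE;
  case: eqP => [ij|nij] us; have := faces l i s lL sl; rewrite inE;
  (have -> : u 0 i < s < v 0 i by rewrite ?ij in us *; lra) => /(_ isT);
  rewrite xpair_eqE => /orP[/andP[/eqP ? /eqP ?]|//]; subst;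
  first [by case: nij | lra].
Qed.

(** Give the boxes of L the weight -1 and those of C the weight 1: the counting hypothesis makes the
    step function nonnegative, and [step_fun_clamp_ge0] transfers this to F. Clamping does not
    change the boxes of L, which lie in [a, b]. *)
Lemma packing (L C : seq ('rV[R]_n * 'rV[R]_n)) :
  le_vec a b ->
  (forall l, l \in L -> [/\ le_vec a l.1, le_vec l.1 l.2 & le_vec l.2 b]) ->
  (forall l, l \in C -> le_vec l.1 l.2) ->
  (forall x, (count (fun l => hbox l.1 l.2 x) L <=
              count (fun l => hbox l.1 l.2 x) C)%N) ->
  \sum_(l <- L) F l.1 l.2 <=
  \sum_(l <- C) F (clamp a b l.1) (clamp a b l.2).
Proof.
move=> ab Lab Cle LC.
pose W := [seq (-1 : R, l) | l <- L] ++ [seq (1 : R, l) | l <- C].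
pose lo (l : R * ('rV[R]_n * 'rV[R]_n)) (j : 'I_n) := (j, l.2.1 0 j).
pose hi (l : R * ('rV[R]_n * 'rV[R]_n)) (j : 'I_n) := (j, l.2.2 0 j).
pose S := [seq lo l j | l <- W, j <- enum 'I_n] ++
          [seq hi l j | l <- W, j <- enum 'I_n].
have Wle l : l \in W -> le_vec l.2.1 l.2.2.
  by rewrite mem_cat => /orP[] /mapP[k kL ->] /=; [case: (Lab _ kL)|exact: Cle].
have cntE (s : seq ('rV[R]_n * 'rV[R]_n)) x :
    \sum_(l <- s) (hbox l.1 l.2 x)%:R =
      (count (fun l => hbox l.1 l.2 x) s)%:R :> R.
  rewrite -sum1_count natr_sum [RHS]big_mkcond /=.
  by apply: eq_bigr => l _; case: hbox.
have := @step_fun_clamp_ge0 W S a b Wle.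
rewrite big_cat !big_map /= => H.
suff : 0 <= \sum_(j <- L) -1 * F (clamp a b j.1) (clamp a b j.2) +
    \sum_(j <- C) 1 * F (clamp a b j.1) (clamp a b j.2).
  rewrite -!mulr_sumr mul1r mulN1r addrC subr_ge0; apply: le_trans.
  rewrite le_eqVlt; apply/orP; left; apply/eqP; apply: eq_big_seq => l lL.
  have [al ll lb] := Lab _ lL.
  rewrite !clamp_id //; first exact: le_vec_trans al ll.
  exact: le_vec_trans ll lb.
apply: H => //.
- move=> x; rewrite big_cat !big_map /= -!mulr_sumr mul1r mulN1r addrC subr_ge0.
  by rewrite !cntE ler_nat.
- move=> l j t lW tl _; rewrite mem_cat; apply/orP.
  case: tl => ->; [left|right].
    by apply: (allpairs_f lo) => //; rewrite mem_enum.
  by apply: (allpairs_f hi) => //; rewrite mem_enum.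
Qed.

End ClampCut.

End Boxes.

(** * Volume as an additive function of boxes *)

Section ClampVolume.
Variables (R : realType) (n : nat).
Implicit Types (a b c d u v x : 'rV[R]_n).

Lemma clamp1_contract (u v c d : R) : c <= d ->
  Num.max u (Num.min d v) - Num.max u (Num.min c v) <= d - c.
Proof.
move=> cd; have [dv|vd] := leP d v.
  rewrite (min_idPl (le_trans cd dv)).
  by case: (leP u d); case: (leP u c); lra.
case: (leP c v); first by case: (leP u v); case: (leP u c); lra.
by lra.
Qed.

Lemma box_volume_ge0 c d : le_vec c d -> 0 <= box_volume c d.
Proof. by move=> cd; apply: prodr_ge0 => j _; rewrite subr_ge0. Qed.

Lemma interval_fun_volume a b : interval_fun a b (@box_volume R n).
Proof.
split=> [c d _ cd _|c d j t _ cd _ _]; first exact: box_volume_ge0.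
rewrite /box_volume (bigD1 j) //= [X in _ = X + _](bigD1 j) //=.
rewrite [X in _ = _ + X](bigD1 j) //= !mxE eqxx.
rewrite [X in _ = _ * X + _](eq_bigr (fun i => d 0 i - c 0 i)); last first.
  by move=> i /negPf ij; rewrite mxE ij.
rewrite [X in _ = _ + _ * X](eq_bigr (fun i => d 0 i - c 0 i)); last first.
  by move=> i /negPf ij; rewrite mxE ij.
by ring.
Qed.

Lemma box_volume_clamp u v c d : le_vec c d ->
  box_volume (clamp u v c) (clamp u v d) <= box_volume c d.
Proof.
move=> cd; apply: ler_prod => j _; rewrite subr_ge0 le_clamp //=.
by rewrite !mxE clamp1_contract.
Qed.

Lemma box_volume_cube x h : box_volume x (x + const_mx h) = h ^+ n.
Proof.
rewrite /box_volume (eq_bigr (fun=> h)) ?prodr_const ?card_ord // => j _.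
by rewrite !mxE; ring.
Qed.

Lemma box_volume_refl x : (0 < n)%N -> box_volume x x = 0.
Proof.
by case: n x => // m x _; rewrite /box_volume big_ord_recl subrr mul0r.
Qed.

End ClampVolume.

(** * Countable covers by half-open boxes and negligible sets *)

Lemma ler_sum_sub_uniq (R : numDomainType) (T : eqType) (s t : seq T)
    (h : T -> R) : uniq s -> uniq t -> {subset s <= t} ->
  (forall p, 0 <= h p) -> \sum_(p <- s) h p <= \sum_(p <- t) h p.
Proof.
move=> us ut st h0.
have sE : perm_eq s [seq p <- t | p \in s].
  apply: uniq_perm => //; first exact: filter_uniq.
  by move=> p; rewrite mem_filter; case: (boolP (p \in s)) => //= /st ->.
rewrite (perm_big _ sE) big_filter big_mkcond.
by apply: ler_sum => p _; case: ifP.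
Qed.

Section Covers.
Variables (R : realType) (n : nat) (n_gt0 : (0 < n)%N).
Implicit Types (X Y : set 'rV[R]_n) (v w e : R).

(** Bounding all partial sums keeps the total volume real-valued; the infimum of the admissible v is
    the outer measure of X. *)
Definition covered X v : Prop := exists C : nat -> 'rV[R]_n * 'rV[R]_n,
  [/\ forall k, le_vec (C k).1 (C k).2,
      forall x, X x -> exists k, hbox (C k).1 (C k).2 x &
      forall N, \sum_(k < N) box_volume (C k).1 (C k).2 <= v].

Definition negligible_vec X : Prop := forall e, 0 < e -> covered X e.

Lemma covered_sub X Y v w : X `<=` Y -> v <= w -> covered Y v -> covered X w.
Proof.
move=> XY vw [C [Cle YC CV]]; exists C; split=> // [x /XY/YC //|N].
exact: le_trans vw.
Qed.

Lemma covered_ge0 X v : covered X v -> 0 <= v.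
Proof. by move=> [C [_ _ /(_ 0%N)]]; rewrite big_ord0. Qed.

Lemma covered_seq (L : seq ('rV[R]_n * 'rV[R]_n)) :
  (forall l, l \in L -> le_vec l.1 l.2) ->
  covered [set x | has (fun l => hbox l.1 l.2 x) L]
    (\sum_(l <- L) box_volume l.1 l.2).
Proof.
move=> Lle; pose z := (0 : 'rV[R]_n, 0 : 'rV[R]_n).
have Cle k : le_vec (nth z L k).1 (nth z L k).2.
  have [/(mem_nth z)/Lle//|kL] := ltnP k (size L).
  by rewrite nth_default.
exists (nth z L); split=> //.
- by move=> x /= /hasP[l lL xl]; exists (index l L); rewrite nth_index.
- move=> N; rewrite (big_nth z).
  rewrite -(big_mkord xpredT (fun k => box_volume (nth z L k).1 (nth z L k).2)).
  have [NL|LN] := leqP N (size L).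
    rewrite [leRHS] (big_cat_nat (n := N) (m := 0) (p := size L)) //= lerDl.
    by apply: sumr_ge0 => k _; apply: box_volume_ge0.
  rewrite (big_cat_nat (n := size L)) ?(ltnW LN) //=.
  rewrite [X in _ + X <= _]big_nat_cond [X in _ + X <= _]big1 ?addr0 //.
  by move=> k /andP[/andP[Lk _] _]; rewrite nth_default ?box_volume_refl.
Qed.

Lemma covered0 : covered set0 0.
Proof.
by apply: covered_sub (covered_seq (L := [::]) _); rewrite ?big_nil.
Qed.

(** The double sequence of boxes is enumerated through a coding of pairs. A partial sum involves
    finitely many pairs, all in some square M x M, and the rows of that square cost at most the sum
    of the first M values of v. *)
Lemma covered_bigcup (X : nat -> set 'rV[R]_n) (v : nat -> R) w :
  (forall i, covered (X i) (v i)) -> (forall N, \sum_(i < N) v i <= w) ->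
  covered (\bigcup_i X i) w.
Proof.
move=> /choice[C CP] vw.
pose g (p : nat * nat) := C p.1 p.2.
pose pinv (m : nat) : option (nat * nat) := pickle_inv m.
(* Numbers that code no pair get a box of volume 0. *)
pose D m := if pinv m is Some p then g p else (0, 0).
have g0 p : 0 <= box_volume (g p).1 (g p).2.
  by apply: box_volume_ge0; case: (CP p.1) => + _ _; apply.
exists D; split=> [k|x [i _ Xix]|N].
- by rewrite /D; case: (pinv k) => // p; case: (CP p.1) => + _ _; apply.
- have [_ /(_ _ Xix)[k xk] _] := CP i.
  by exists (pickle (i, k)); rewrite /D /pinv pickleK_inv.
- pose s := pmap pinv (iota 0 N).
  have -> : \sum_(k < N) box_volume (D k).1 (D k).2 =
      \sum_(p <- s) box_volume (g p).1 (g p).2.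
    rewrite -(big_mkord xpredT (fun k => box_volume (D k).1 (D k).2)).
    rewrite /index_iota subn0 /s.
    elim: (iota 0 N) => [|m t IH]; first by rewrite !big_nil.
    rewrite big_cons IH /= /D; case: (pinv m) => [p|] /=.
      by rewrite big_cons.
    by rewrite box_volume_refl // add0r.
  have us : uniq s.
    exact: (pmap_uniq (@pickle_invK (nat * nat)%type) (iota_uniq 0 N)).
  pose M := (\sum_(p <- s) (p.1 + p.2)).+1.
  have sM p : p \in s -> (p.1 < M)%N /\ (p.2 < M)%N.
    move=> ps; have : (p.1 + p.2 < M)%N.
      by rewrite ltnS (big_rem p ps) /= leq_addr.
    by move=> h; split; apply: leq_ltn_trans h; rewrite ?leq_addr ?leq_addl.
  pose t := [seq (i, k) | i <- iota 0 M, k <- iota 0 M].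
  apply: (@le_trans _ _ (\sum_(p <- t) box_volume (g p).1 (g p).2)).
    apply: ler_sum_sub_uniq => //.
      by apply: allpairs_uniq; rewrite ?iota_uniq // => -[? ?] [? ?].
    move=> p /sM[p1 p2]; rewrite [p]surjective_pairing; apply: allpairs_f;
      by rewrite mem_iota.
  rewrite big_allpairs -[iota 0 M]/(index_iota 0 M) big_mkord.
  apply: le_trans (vw M); apply: ler_sum => i _; rewrite big_mkord.
  by have [_ _ /(_ M)] := CP i.
Qed.

Lemma coveredU X Y v w : covered X v -> covered Y w ->
  covered (X `|` Y) (v + w).
Proof.
move=> Xv Yw.
pose Z i := nth set0 [:: X; Y] i; pose z i := nth 0 [:: v; w] i.
apply: (@covered_sub _ (\bigcup_i Z i) _ (v + w)) => //.
  by move=> x [Xx|Yx]; [exists 0%N|exists 1%N].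
apply: (@covered_bigcup Z z) => [[|[|i]]//|[|[|N]]].
- by rewrite /Z /z /= !nth_nil; apply: covered0.
- by rewrite big_ord0 addr_ge0 // ?(covered_ge0 Xv) ?(covered_ge0 Yw).
- by rewrite big_ord1 lerDl (covered_ge0 Yw).
- by rewrite !big_ord_recl big1 ?addr0 // => i _; rewrite /z /= nth_nil.
Qed.

Lemma negligible_vec_sub X Y : X `<=` Y -> negligible_vec Y -> negligible_vec X.
Proof. by move=> XY Y0 e /Y0; apply: covered_sub. Qed.

(** The i-th set is covered at cost e / 2^(i+1), and these costs add up to at most e. *)
Lemma negligible_vec_bigcup (X : nat -> set 'rV[R]_n) :
  (forall i, negligible_vec (X i)) -> negligible_vec (\bigcup_i X i).
Proof.
move=> X0 e e0; apply: (@covered_bigcup X (fun i => e / 2 ^+ i.+1)) => [i|N].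
  by apply: X0; rewrite divr_gt0 // exprn_gt0.
suff -> : \sum_(i < N) e / 2 ^+ i.+1 = e - e / 2 ^+ N.
  by rewrite gerBl divr_ge0 // ?exprn_ge0 // ltW.
elim: N => [|N IH]; first by rewrite big_ord0 expr0 divr1 subrr.
rewrite big_ord_recr IH /= exprS; field.
by rewrite expf_neq0 // pnatr_eq0.
Qed.

Lemma negligible_vecU X Y :
  negligible_vec X -> negligible_vec Y -> negligible_vec (X `|` Y).
Proof.
move=> X0 Y0 e e0; rewrite [e]splitr.
by apply: coveredU; [apply: X0|apply: Y0]; rewrite divr_gt0.
Qed.

Lemma negligible_vec_countable (T : countType) (X : T -> set 'rV[R]_n) :
  (forall i, negligible_vec (X i)) -> negligible_vec (\bigcup_i X i).
Proof.
move=> X0; pose Y m := if unpickle m is Some t then X t else set0.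
apply: (@negligible_vec_sub _ (\bigcup_i Y i)).
  by move=> x [t _ Xt]; exists (pickle t) => //; rewrite /Y pickleK.
apply: negligible_vec_bigcup => m; rewrite /Y; case: unpickle => // e e0.
exact: covered_sub (ltW e0) covered0.
Qed.

End Covers.

(** * Vitali coverings by half-open cubes *)

Section Vitali.
Variables (R : realType) (n : nat) (n_gt0 : (0 < n)%N).
Implicit Types (a b c d x z : 'rV[R]_n) (h e : R) (l : 'rV[R]_n * R)
  (L : seq ('rV[R]_n * R)) (E : set 'rV[R]_n)
  (C : seq ('rV[R]_n * 'rV[R]_n)) (F : 'rV[R]_n -> 'rV[R]_n -> R).

Definition cube l : pred 'rV[R]_n := hbox l.1 (l.1 + const_mx l.2).

Definition in_cube z : pred ('rV[R]_n * R) := fun l => cube l z.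

Definition frequently0 (P : R -> Prop) : Prop :=
  forall e, 0 < e -> exists h, [/\ 0 < h, h < e & P h].

Lemma le_vec_cube x h : 0 <= h -> le_vec x (x + const_mx h).
Proof. by move=> h0 j; rewrite !mxE lerDl. Qed.

(** If x_j < c_j for some j, a side below c_j - x_j keeps the cube away; if x_j >= d_j, the cube
    extends upwards from x and never meets the box. *)
Lemma small_cube_avoid c d x : ~~ hbox c d x ->
  exists2 e, 0 < e &
    forall h, h < e -> forall z, hbox c d z -> ~~ cube (x, h) z.
Proof.
rewrite negb_forall => /existsP[j]; rewrite negb_and -ltNge -leNgt.
case/orP=> [xc|dx].
  exists (c 0 j - x 0 j); first by rewrite subr_gt0.
  move=> h hd z /hboxP/(_ j)/andP[cz _]; apply/hboxP => /(_ j) /=.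
  by rewrite !mxE; lra.
exists 1 => // h _ z /hboxP/(_ j)/andP[_ zd]; apply/hboxP => /(_ j) /=.
by rewrite !mxE; lra.
Qed.

Lemma small_cube_inside c d x : hbox c d x ->
  exists2 e, 0 < e & forall h, h < e -> le_vec (x + const_mx h) d.
Proof.
move=> /hboxP xcd; exists (\big[Num.min/1]_(j < n) (d 0 j - x 0 j)).
  apply/bigmin_gtP; split=> // j _; rewrite subr_gt0.
  by case/andP: (xcd j).
move=> h /bigmin_gtP[_ hd] j; rewrite !mxE.
by move: (hd j isT); lra.
Qed.

Definition avoids L l : Prop :=
  forall k, k \in L -> forall z, cube k z -> ~~ cube l z.

Lemma small_cube_avoids L x : ~~ has (in_cube x) L ->
  exists2 e, 0 < e & forall h, h < e -> avoids L (x, h).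
Proof.
elim: L => [_|k L IH]; first by exists 1.
rewrite /= negb_or => /andP[/small_cube_avoid[e e0 ek] /IH[e' e'0 eL]].
exists (Num.min e e'); first by rewrite lt_min e0.
move=> h; rewrite lt_min => /andP[he he'] k'; rewrite inE => /orP[/eqP ->|].
  exact: ek.
exact: eL.
Qed.

Lemma avoids_count L l z :
  avoids L l -> (count (in_cube z) L <= 1)%N ->
  (count (in_cube z) (l :: L) <= 1)%N.
Proof.
move=> Ll; have [lz|/negPf lz] := boolP (cube l z); last first.
  by rewrite /= /in_cube lz.
rewrite /= /in_cube lz (@eq_in_count _ _ pred0) ?count_pred0 // => k kL /=.
by apply/negP => /(Ll _ kL); rewrite lz.
Qed.

Lemma hbox_lb c d x : hbox c d x -> le_vec c x.
Proof. by move=> /hboxP xcd j; case/andP: (xcd j). Qed.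

Lemma cube_sub_hbox c d l z : le_vec c l.1 -> le_vec (l.1 + const_mx l.2) d ->
  cube l z -> hbox c d z.
Proof.
move=> cl ld /hboxP lz; apply/hboxP => j; have /andP[l1 l2] := lz j.
by rewrite (le_trans (cl j) l1) (lt_le_trans l2 (ld j)).
Qed.

Lemma leq_count_has (T1 T2 : Type) (P : pred T1) (Q : pred T2) (s : seq T1)
    (t : seq T2) : (count P s <= 1)%N -> (has P s -> has Q t) ->
  (count P s <= count Q t)%N.
Proof.
move=> s1 st; case: (posnP (count P s)) => [-> //|]; rewrite -has_count => /st.
by rewrite has_count; apply: leq_trans.
Qed.

Lemma cube_packing a b F L C : interval_fun a b F -> le_vec a b ->
  (forall l, l \in L ->
     [/\ 0 < l.2, le_vec a l.1 & le_vec (l.1 + const_mx l.2) b]) ->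
  (forall k, k \in C -> le_vec k.1 k.2) ->
  (forall z, (count (in_cube z) L <= 1)%N) ->
  (forall z, has (in_cube z) L -> has (fun k => hbox k.1 k.2 z) C) ->
  \sum_(l <- L) F l.1 (l.1 + const_mx l.2) <=
  \sum_(l <- C) F (clamp a b l.1) (clamp a b l.2).
Proof.
move=> FI ab Lab Cle L1 LC.
have := @packing R n a b F FI [seq (l.1, l.1 + const_mx l.2) | l <- L] C ab.
rewrite big_map; apply=> // [_ /mapP[l lL ->] /=|x].
  have [h0 al lb] := Lab _ lL.
  by split=> //; apply: le_vec_cube; exact: ltW.
by rewrite count_map; apply: leq_count_has; [exact: L1|exact: LC].
Qed.

Lemma cube_packing_box a b F L : interval_fun a b F -> le_vec a b ->
  (forall l, l \in L ->
     [/\ 0 < l.2, le_vec a l.1 & le_vec (l.1 + const_mx l.2) b]) ->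
  (forall z, (count (in_cube z) L <= 1)%N) ->
  \sum_(l <- L) F l.1 (l.1 + const_mx l.2) <= F a b.
Proof.
move=> FI ab Lab L1; have := @cube_packing a b F L [:: (a, b)] FI ab Lab.
rewrite big_seq1 /= !clamp_id //; apply=> // [l|z /hasP[l lL lz]].
  by rewrite inE => /eqP ->.
have [_ al lb] := Lab _ lL.
by rewrite orbF; exact: cube_sub_hbox lz.
Qed.

(** Cubes are chosen greedily, each disjoint from the earlier ones. They are packed in [a, b], so
    their volumes are summable; the points of E left after N choices lie in threefold enlargements
    of later cubes, whose total volume is 3^n times a tail of that series. *)
Lemma vitali_cubes a b E (P : 'rV[R]_n -> R -> Prop) e :
  (forall x h, P x h ->
     [/\ 0 < h, le_vec a x & le_vec (x + const_mx h) b]) ->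
  (forall x, E x -> frequently0 (P x)) -> 0 < e ->
  exists L, [/\ forall l, l \in L -> P l.1 l.2,
    forall z, (count (in_cube z) L <= 1)%N &
    covered (E `\` [set z | has (in_cube z) L]) e].
Proof.
(* If no finite disjoint family leaves a rest of cost e, the greedy choice never gets stuck and
   yields an infinite sequence. *)
move=> Pab EP e0; apply: contrapT => noL.
pose valid L := (forall l, l \in L -> P l.1 l.2) /\
  forall z, (count (in_cube z) L <= 1)%N.
have {}noL L : valid L -> ~ covered (E `\` [set z | has (in_cube z) L]) e.
  by move=> [L1 L2] L3; apply: noL; exists L.
(* greedy choice: some admissible cube at least half as large as any other *)
have /choice[next nextP] L : exists l, valid L -> [/\ P l.1 l.2, avoids L l &
    forall l', P l'.1 l'.2 -> avoids L l' -> l'.2 <= 2 * l.2].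
  have [vL|nvL] := pselect (valid L); last by exists (0, 0).
  pose H := [set h | exists x, P x h /\ avoids L (x, h)].
  have [x [h [Pxh Lxh]]] : exists x h, P x h /\ avoids L (x, h).
    apply: contrapT => none; apply: (noL _ vL).
    apply: covered_sub (ltW e0) (covered0 _ n_gt0) => x [Ex /negP nLx].
    have [d d0 dL] := small_cube_avoids nLx.
    have [h [h0 hd Pxh]] := EP _ Ex _ d0.
    by apply: none; exists x, h; split=> //; exact: dL.
  have Hsup : has_sup H.
    split; first by exists h, x.
    pose j := Ordinal n_gt0.
    exists (b 0 j - a 0 j) => k [y [/Pab[k0 ay yb] _]].
    by move: (ay j) (yb j); rewrite !mxE; lra.
  have sup0 : 0 < sup H.
    have [h0 _ _] := Pab _ _ Pxh.
    by apply: lt_le_trans h0 _; apply: sup_upper_bound => //; exists x.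
  have [k [y [Pyk Lyk]] ksup] := sup_adherent (divr_gt0 sup0 (ltr0n R 2)) Hsup.
  exists (y, k) => _; split=> // -[x' h'] /= Px' Lx'.
  have : h' <= sup H by apply: sup_upper_bound => //; exists x'.
  by lra.
pose Ls N := iter N (fun L => next L :: L) [::].
pose l_ N := next (Ls N).
have vLs N : valid (Ls N).
  elim: N => [|N IH]; first by split.
  have [Pl Ll _] := nextP _ IH; split=> [k|z].
    by rewrite inE => /orP[/eqP -> //|]; case: IH => + _; apply.
  by apply: avoids_count => //; case: IH.
have PLs N : P (l_ N).1 (l_ N).2 by have [] := nextP _ (vLs N).
have l0 N : 0 < (l_ N).2 by have [] := Pab _ _ (PLs N).
pose u N := (l_ N).2 ^+ n.
have u0 N : 0 < u N by rewrite exprn_gt0.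
have serE N : series u N = \sum_(l <- Ls N) l.2 ^+ n.
  elim: N => [|N IH]; first by rewrite /series /= big_geq // big_nil.
  by rewrite seriesSr IH /= big_cons addrC.
have ab : le_vec a b.
  have [h0 al lb] := Pab _ _ (PLs 0%N).
  exact: le_vec_trans al (le_vec_trans (le_vec_cube _ (ltW h0)) lb).
have u_bounded N : series u N <= box_volume a b.
  rewrite serE (eq_bigr (fun l => box_volume l.1 (l.1 + const_mx l.2))).
    apply: cube_packing_box (interval_fun_volume a b) ab _ (vLs N).2.
    by move=> l lL; exact: Pab ((vLs N).1 _ lL).
  by move=> l _; rewrite box_volume_cube.
have u_nd : nondecreasing_seq (series u).
  by apply/nondecreasing_seqP => N; rewrite seriesSr lerDl ltW.
have u_cvg : cvgn (series u).
  apply: nondecreasing_is_cvgn => //; exists (box_volume a b) => _ [N _ <-].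
  exact: u_bounded.
have e30 : 0 < e / 3 ^+ n by rewrite divr_gt0 // exprn_gt0.
have [N tailN] : exists N, limn (series u) - series u N <= e / 3 ^+ n.
  have /cvgrPdist_le/(_ _ e30)[N _ NP] := u_cvg.
  by exists N; apply: le_trans (ler_norm _) (NP N _) => /=.
apply: (noL _ (vLs N)).
(* The cube [y, y + s) is enlarged to [y - 2 s, y + s): downwards only, since x is the lower corner
   of a cube of side h <= 2 s. *)
exists (fun k => ((l_ (N + k)%N).1 - const_mx (2 * (l_ (N + k)%N).2),
                  (l_ (N + k)%N).1 + const_mx (l_ (N + k)%N).2)); split.
- by move=> k j; rewrite /= !mxE; move: (l0 (N + k)%N); lra.
- move=> x [Ex /negP nLx]; have [d d0 dL] := small_cube_avoids nLx.
  have [h [h0 hd Pxh]] := EP _ Ex _ d0; move/(_ _ hd): dL => dL.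
  (* Otherwise every later cube would have side at least h / 2, although the volumes tend to 0. *)
  have [k nk] : exists k, ~ avoids (Ls (N + k)%N) (x, h).
    apply: contrapT => none.
    have big k : (h / 2) ^+ n <= u (N + k)%N.
      rewrite lerXn2r ?nnegrE ?divr_ge0 ?(ltW h0) ?(ltW (l0 _)) //.
      have [_ _ /(_ (x, h) Pxh)] := nextP _ (vLs (N + k)%N).
      have Lk : avoids (Ls (N + k)%N) (x, h).
        by apply: contrapT => nk; apply: none; exists k.
      by move=> /(_ Lk) /=; rewrite -/(l_ _); lra.
    have h2n : 0 < (h / 2) ^+ n by rewrite exprn_gt0 // divr_gt0.
    have /cvgrPdist_lt/(_ _ h2n)[M _ MP] := cvg_series_cvg_0 u_cvg.
    have := MP (N + M)%N (leq_addl _ _); have := big M.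
    by rewrite sub0r normrN ger0_norm ?(ltW (u0 _)) //; lra.
  (* The first chosen cube that meets [x, x + h): the latter was still available then, so the greedy
     comparison applies. *)
  have {nk} [m [Lm nLm]] : exists m, avoids (Ls (N + m)%N) (x, h) /\
      ~ avoids (Ls (N + m.+1)%N) (x, h).
    elim: k nk => [|k IH]; first by rewrite addn0.
    have [Lk|/IH //] := pselect (avoids (Ls (N + k)%N) (x, h)).
    by exists k.
  (* x + [0, h) meets a selected cube of side s >= h / 2, hence x lies in the
     enlargement of that cube with side 3 s *)
  exists m; have [_ _ /(_ (x, h) Pxh Lm)] := nextP _ (vLs (N + m)%N).
  rewrite -/(l_ _) /= => hm.
  have [z /andP[lz xz]] : exists z, cube (l_ (N + m)%N) z && cube (x, h) z.
    apply: contrapT => none; apply: nLm => i; rewrite addnS inE.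
    move=> /orP[/eqP -> z lz|/Lm //]; apply/negP => xz; apply: none.
    by exists z; rewrite -/(l_ _) in lz; rewrite lz.
  move/hboxP: lz => lz; move/hboxP: xz => xz; apply/hboxP => j.
  by move: (lz j) (xz j); rewrite /= !mxE; lra.
- move=> M /=; rewrite (eq_bigr (fun k : 'I_M => 3 ^+ n * u (N + k)%N)); last first.
    move=> k _; rewrite -exprMn -(box_volume_cube 0).
    by rewrite /box_volume; apply: eq_bigr => j _; rewrite !mxE; ring.
  rewrite -mulr_sumr mulrC -ler_pdivlMr ?exprn_gt0 //; apply: le_trans tailN.
  have -> : \sum_(k < M) u (N + k)%N = series u (N + M)%N - series u N.
    elim: M => [|M IH]; first by rewrite big_ord0 addn0 subrr.
    by rewrite big_ord_recr IH /= addnS seriesSr; ring.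
  by rewrite lerB // nondecreasing_cvgn_le.
Qed.

End Vitali.

(** * Almost everywhere differentiation of additive box functions *)

Section Differentiation.
Variables (R : realType) (n : nat) (n_gt0 : (0 < n)%N).
Implicit Types (a b c d x z : 'rV[R]_n) (h e p q : R)
  (L : seq ('rV[R]_n * R)) (C : seq ('rV[R]_n * 'rV[R]_n))
  (E : set 'rV[R]_n) (F : 'rV[R]_n -> 'rV[R]_n -> R).

Lemma frequently0_imp (P Q : R -> Prop) : (forall h, 0 < h -> P h -> Q h) ->
  frequently0 P -> frequently0 Q.
Proof. by move=> PQ fP e /fP[h [h0 he /(PQ _ h0)]]; exists h. Qed.

Lemma not_frequently0 (P : R -> Prop) : ~ frequently0 P ->
  \forall h \near 0^'+, ~ P h.
Proof.
move=> nP; have [e e0 eP] : exists2 e, 0 < e & forall h, 0 < h -> h < e -> ~ P h.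
  apply: contrapT => none; apply: nP => e e0; apply: contrapT => noh.
  by apply: none; exists e => // h h0 he Ph; apply: noh; exists h.
near=> h; apply: eP; first by near: h; exact: nbhs_right_gt.
by near: h; exact: nbhs_right_lt.
Unshelve. all: by end_near. Qed.

Lemma frequently0_inside (P : R -> Prop) c d x : hbox c d x -> frequently0 P ->
  frequently0 (fun h => P h /\ le_vec (x + const_mx h) d).
Proof.
move=> /small_cube_inside[e e0 eb] fP e' e'0.
have [|h [h0]] := fP (Num.min e e'); first by rewrite lt_min e0.
by rewrite lt_min => /andP[he he'] Ph; exists h; split=> //; split=> //; exact: eb.
Qed.

Lemma covered_cubes L : (forall l, l \in L -> 0 < l.2) ->
  covered [set z | has (in_cube z) L] (\sum_(l <- L) l.2 ^+ n).
Proof.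
move=> L0; have := @covered_seq R n n_gt0 [seq (l.1, l.1 + const_mx l.2) | l <- L].
rewrite big_map; under eq_bigr do rewrite box_volume_cube.
have -> : [set x | has (fun l => hbox l.1 l.2 x)
    [seq (l.1, l.1 + const_mx l.2) | l <- L]] = [set z | has (in_cube z) L].
  by apply/seteqP; split=> x /=; rewrite has_map.
apply=> _ /mapP[l /L0 l0 ->] /=; apply: le_vec_cube; exact: ltW.
Qed.

(** Disjoint Vitali cubes with F >= q h^n lie in [a, b], so packing bounds q times their total
    volume by F a b; the term e pays for the points they miss. *)
Lemma weak_type a b F E q e : interval_fun a b F -> le_vec a b ->
  0 < q -> 0 < e -> (forall x, E x -> hbox a b x) ->
  (forall x, E x -> frequently0 (fun h => q * h ^+ n <= F x (x + const_mx h))) ->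
  covered E (F a b / q + e).
Proof.
move=> FI ab q0 e0 Eab EF.
have [||L [PL L1 EL]] := @vitali_cubes R n n_gt0 a b E (fun x h =>
    [/\ 0 < h, le_vec a x, le_vec (x + const_mx h) b &
        q * h ^+ n <= F x (x + const_mx h)]) e _ _ e0.
- by move=> x h [].
- move=> x Ex; have xab := Eab _ Ex.
  apply: frequently0_imp (frequently0_inside xab (EF _ Ex)) => h h0 [Fh hb].
  by split=> //; exact: hbox_lb xab.
have Lab l : l \in L ->
    [/\ 0 < l.2, le_vec a l.1 & le_vec (l.1 + const_mx l.2) b].
  by move=> /PL[].
have Lcov : covered [set z | has (in_cube z) L] (\sum_(l <- L) l.2 ^+ n).
  by apply: covered_cubes => l /Lab[].
rewrite addrC; apply: covered_sub (coveredU n_gt0 EL Lcov).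
  by move=> x Ex; case: (pselect (has (in_cube x) L)) => h; [right|left].
rewrite lerD2l ler_pdivlMr // mulrC mulr_sumr.
apply: le_trans (cube_packing_box FI ab Lab L1).
by rewrite big_seq [leRHS]big_seq; apply: ler_sum => l /PL[].
Qed.

Lemma seq_bounded_index (T : eqType) (s : seq T) (Q : T -> nat -> Prop) :
  (forall l, l \in s -> exists m, Q l m) ->
  exists K, forall l, l \in s -> exists2 m, (m < K)%N & Q l m.
Proof.
elim: s => [_|l s IH sQ]; first by exists 0%N.
have [m lm] := sQ l (mem_head _ _).
have [|K KP] := IH; first by move=> k ks; apply: sQ; rewrite inE ks orbT.
exists (maxn K m.+1) => k; rewrite inE => /orP[/eqP ->|/KP[i iK Qi]].
  by exists m => //; rewrite leq_max ltnSn orbT.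
by exists i => //; rewrite leq_max iK.
Qed.

(** Let s be the outer measure of E. A Vitali family I with F <= p h^n sits inside a cover of volume
    below s + e; a second family J with F >= q h^n sits inside the cubes of I and covers E up to
    cost 2 e. With |.| for total volume, q (s - 2 e) <= q |J| <= F(J) <= F(I) <= p |I| <= p (s + e),
    and small e forces s = 0. *)
Lemma density_gap a b F E p q : interval_fun a b F -> le_vec a b ->
  0 < p -> p < q -> (forall x, E x -> hbox a b x) ->
  (forall x, E x -> frequently0 (fun h => F x (x + const_mx h) <= p * h ^+ n)) ->
  (forall x, E x -> frequently0 (fun h => q * h ^+ n <= F x (x + const_mx h))) ->
  negligible_vec E.
Proof.
move=> FI ab p0 pq Eab Ep Eq.
pose S := [set v | covered E v].
have Sinf : has_inf S.
  split; last by exists 0 => v /covered_ge0.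
  exists (\sum_(l <- [:: (a, b)]) box_volume l.1 l.2).
  apply: covered_sub (lexx _) (covered_seq n_gt0 _).
    by move=> x /Eab xab; rewrite /= xab.
  by move=> l; rewrite inE => /eqP ->.
have q0 : 0 < q by exact: lt_trans pq.
have key e : 0 < e -> q * (inf S - 2 * e) <= p * (inf S + e).
  move=> e0; have [v [C [Cle EC Cv]] ve] := inf_adherent e0 Sinf.
  have [||I [PI I1 EI]] := @vitali_cubes R n n_gt0 a b E (fun x h =>
    [/\ 0 < h, le_vec a x, le_vec (x + const_mx h) b &
        F x (x + const_mx h) <= p * h ^+ n /\
        exists m, le_vec (C m).1 x /\ le_vec (x + const_mx h) (C m).2]) e _ _ e0.
  - by move=> x h [].
  - move=> x Ex; have xab := Eab _ Ex; have [m xm] := EC _ Ex.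
    apply: frequently0_imp (frequently0_inside xm
      (frequently0_inside xab (Ep _ Ex))) => h h0 [[Fh hb] hm].
    split=> //; first exact: hbox_lb xab.
    by split=> //; exists m; split=> //; exact: hbox_lb xm.
  pose E1 := E `&` [set z | has (in_cube z) I].
  have [||J [PJ J1 EJ]] := @vitali_cubes R n n_gt0 a b E1 (fun x h =>
    [/\ 0 < h, le_vec a x, le_vec (x + const_mx h) b &
        q * h ^+ n <= F x (x + const_mx h) /\ exists2 l, l \in I &
          le_vec l.1 x /\ le_vec (x + const_mx h) (l.1 + const_mx l.2)]) e _ _ e0.
  - by move=> x h [].
  - move=> x [Ex /= /hasP[l lI xl]]; have xab := Eab _ Ex.
    apply: frequently0_imp (frequently0_inside xl
      (frequently0_inside xab (Eq _ Ex))) => h h0 [[Fh hb] hl].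
    split=> //; first exact: hbox_lb xab.
    by split=> //; exists l => //; split=> //; exact: hbox_lb xl.
  have Iab l : l \in I ->
      [/\ 0 < l.2, le_vec a l.1 & le_vec (l.1 + const_mx l.2) b].
    by move=> /PI[].
  have Jab l : l \in J ->
      [/\ 0 < l.2, le_vec a l.1 & le_vec (l.1 + const_mx l.2) b].
    by move=> /PJ[].
  (* The finitely many cubes of I lie in finitely many boxes of the cover, so packing applies to
     volume; clamping to [a, b] does not increase the volume of these boxes. *)
  have Iv : \sum_(l <- I) l.2 ^+ n <= v.
    have [K KP] := @seq_bounded_index _ I (fun l m => le_vec (C m).1 l.1 /\
      le_vec (l.1 + const_mx l.2) (C m).2) (fun l lI =>
        let: And4 _ _ _ (conj _ H) := PI l lI in H).
    have := @cube_packing R n a b _ I [seq C k | k <- iota 0 K]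
      (interval_fun_volume a b) ab Iab.
    rewrite big_map (eq_bigr (fun l => l.2 ^+ n)) => [H|l _]; last first.
      exact: box_volume_cube.
    apply: le_trans (H _ I1 _) _.
    - by move=> _ /mapP[k _ ->].
    - move=> z /hasP[l lI lz]; have [m mK [Cl lC]] := KP _ lI.
      rewrite has_map; apply/hasP; exists m; first by rewrite mem_iota.
      exact: cube_sub_hbox lz.
    - apply: le_trans (Cv K).
      have -> : iota 0 K = index_iota 0 K by rewrite /index_iota subn0.
      rewrite big_mkord.
      by apply: ler_sum => k _; apply: box_volume_clamp.
  have JI : \sum_(l <- J) F l.1 (l.1 + const_mx l.2) <=
      \sum_(l <- I) F l.1 (l.1 + const_mx l.2).
    have := @cube_packing R n a b F J [seq (l.1, l.1 + const_mx l.2) | l <- I]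
      FI ab Jab.
    rewrite big_map => H; apply: le_trans (H _ J1 _) _.
    - by move=> _ /mapP[l /Iab[l0 _ _] ->]; apply: le_vec_cube; exact: ltW.
    - move=> z /hasP[l lJ lz]; have [_ _ _ [_ [k kI [kl lk]]]] := PJ _ lJ.
      by rewrite has_map; apply/hasP; exists k => //; exact: cube_sub_hbox lz.
    - rewrite big_seq [leRHS]big_seq.
      apply: ler_sum => l /Iab[/ltW l0 al lb] /=.
      have ll := le_vec_cube l.1 l0.
      rewrite !clamp_id //; first exact: le_vec_trans al ll.
  exact: le_vec_trans ll lb.
  have Jcov : covered [set z | has (in_cube z) J] (\sum_(l <- J) l.2 ^+ n).
    by apply: covered_cubes => l /Jab[].
  have Ecov : covered E (e + (e + \sum_(l <- J) l.2 ^+ n)).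
    apply: covered_sub (lexx _) (coveredU n_gt0 EI (coveredU n_gt0 EJ Jcov)).
    move=> x Ex; have [xI|] := pselect (has (in_cube x) I); last by left.
    right; have [xJ|xJ] := pselect (has (in_cube x) J); first by right.
    by left.
  have sJ : inf S <= e + (e + \sum_(l <- J) l.2 ^+ n).
    by apply: ge_inf => //; case: Sinf.
  have qJ : q * \sum_(l <- J) l.2 ^+ n <= p * \sum_(l <- I) l.2 ^+ n.
    rewrite !mulr_sumr.
    apply: (@le_trans _ _ (\sum_(l <- J) F l.1 (l.1 + const_mx l.2))).
      by rewrite big_seq [leRHS]big_seq; apply: ler_sum => l /PJ[_ _ _ []].
    apply: le_trans JI _.
    by rewrite big_seq [leRHS]big_seq; apply: ler_sum => l /PI[_ _ _ []].
  apply: (@le_trans _ _ (q * \sum_(l <- J) l.2 ^+ n)).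
    by rewrite ler_pM2l //; lra.
  by apply: le_trans qJ _; rewrite ler_pM2l //; lra.
have s0 : inf S <= 0.
  rewrite leNgt; apply/negP => s0.
  have r0 : 0 < 2 * (2 * q + p) by lra.
  have d0 : 0 < (q - p) * inf S by rewrite mulr_gt0 // subr_gt0.
  (* For this e, [key] amounts to (q - p) s <= (q - p) s / 2 with s = [inf S]. *)
  pose e := (q - p) * inf S / (2 * (2 * q + p)).
  have eE : e * (2 * (2 * q + p)) = (q - p) * inf S by rewrite /e divfK // gt_eqF.
  have := key e (divr_gt0 d0 r0); move: e eE => e eE.
  by move: eE d0; lra.
move=> e e0; have [v Sv ve] := inf_adherent e0 Sinf.
by apply: covered_sub Sv => //; lra.
Qed.

(** The limit is the supremum of the eventual lower bounds, that is, the lower limit; a larger upper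
    limit would leave room for two rationals in between, which the last hypothesis excludes. *)
Lemma cvg_at_right0 (g : R -> R) :
  ~ frequently0 (fun h => g h < 0) ->
  (exists M, ~ frequently0 (fun h => M <= g h)) ->
  (forall r s : rat, 0 < ratr r :> R -> ratr r < ratr s :> R ->
    frequently0 (fun h => g h <= ratr r) ->
    ~ frequently0 (fun h => ratr s <= g h)) ->
  cvg (g h @[h --> 0^'+]).
Proof.
move=> /not_frequently0 g0 [M /not_frequently0 gM] gap.
pose S := [set y | \forall h \near 0^'+, y <= g h].
have S0 : S 0 by near=> h; rewrite leNgt; apply/negP; near: h.
have Ssup : has_sup S.
  split; first by exists 0.
  exists M => y Sy; have : \forall h \near 0^'+, y <= g h /\ ~ M <= g h.
    by near=> h; split; near: h.
  move=> /(@filter_ex _ _ (at_right_proper_filter (0 : R)))[h [yh /negP]].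
  by rewrite -ltNge => /(le_lt_trans yh)/ltW.
have s0 : 0 <= sup S by exact: sup_upper_bound.
apply/cvg_ex; exists (sup S); apply/cvgrPdist_le => e e0.
have [y Sy ye] := sup_adherent e0 Ssup.
(* As r exceeds the supremum, it is no eventual lower bound and g <= r frequently; hence g < t
   eventually. *)
have [r] := @rat_in_itvoo _ (sup S) (sup S + e) (ltac:(lra)).
rewrite in_itv /= => /andP[sr re].
have [t] := @rat_in_itvoo _ _ _ re; rewrite in_itv /= => /andP[rt te].
have /not_frequently0 gt : ~ frequently0 (fun h => ratr t <= g h).
  apply: (gap r t) => //; first exact: le_lt_trans sr.
  apply: contrapT => /not_frequently0 gr.
  suff /(sup_upper_bound Ssup) : S (ratr r) by lra.
  by apply: filterS gr => h /negP; rewrite -ltNge => /ltW.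
near=> h; rewrite ler_norml; apply/andP; split.
  have : g h < ratr t by rewrite ltNge; apply/negP; near: h.
  by lra.
have : y <= g h by near: h.
by lra.
Unshelve. all: by end_near. Qed.

(** Where the quotient diverges, its upper limit is infinite or two rationals separate the lower and
    upper limits. [weak_type] handles the first set, [density_gap] the second for each of the
    countably many pairs. *)
Lemma ae_quotient_cvg a b F : interval_fun a b F -> le_vec a b ->
  negligible_vec [set x | hbox a b x /\
    ~ cvg (F x (x + const_mx h) / h ^+ n @[h --> 0^'+])].
Proof.
move=> FI ab.
pose g x h := F x (x + const_mx h) / h ^+ n.
pose Einf := [set x | hbox a b x /\ forall M, frequently0 (fun h => M <= g x h)].
pose Egap (rs : rat * rat) := [set x | [/\ hbox a b x,
  0 < ratr rs.1 :> R /\ ratr rs.1 < ratr rs.2 :> R,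
  frequently0 (fun h => g x h <= ratr rs.1) &
  frequently0 (fun h => ratr rs.2 <= g x h)]].
have Einf0 : negligible_vec Einf.
  move=> e e0; have Fab : 0 <= F a b by case: FI => + _; apply.
  (* This level q gives F a b / q <= e / 2; the added 1 keeps it positive when F a b = 0. *)
  have q0 : 0 < 2 * (F a b + 1) / e by rewrite divr_gt0 // mulr_gt0 //; lra.
  have e20 : 0 < e / 2 by rewrite divr_gt0.
  apply: (covered_sub _ _ (weak_type (E := Einf) FI ab q0 e20 _ _)) => //.
  - rewrite [leRHS]splitr lerD2r invf_div mulrA ler_pdivrMr ?mulr_gt0 //; last lra.
    by rewrite mulrC [leRHS]mulrC; nra.
  - by move=> x [].
  - move=> x [_ xM]; apply: frequently0_imp (xM (2 * (F a b + 1) / e)) => h h0.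
    by rewrite /g ler_pdivlMr ?exprn_gt0.
have Egap0 : negligible_vec (\bigcup_rs Egap rs).
  apply: negligible_vec_countable => // rs.
  have [[r0 rs12]|nrs] := pselect (0 < ratr rs.1 :> R /\ ratr rs.1 < ratr rs.2 :> R);
    last by move=> e e0; apply: covered_sub (ltW e0) (covered0 _ n_gt0) => x [].
  apply: (density_gap (p := ratr rs.1) (q := ratr rs.2) FI ab) => //.
  - by move=> x [].
  - move=> x [_ _ + _]; apply: frequently0_imp => h h0.
    by rewrite /g ler_pdivrMr ?exprn_gt0.
  - move=> x [_ _ _]; apply: frequently0_imp => h h0.
    by rewrite /g ler_pdivlMr ?exprn_gt0.
apply: negligible_vec_sub (negligible_vecU n_gt0 Einf0 Egap0).
move=> x [xab ncvg]; apply: contrapT => nx; apply: ncvg.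
apply: cvg_at_right0.
- move=> neg; have [h [h0 _ [gh hb]]] := frequently0_inside xab neg ltr01.
  have F0 : 0 <= F x (x + const_mx h).
    by apply: FI.1 => //; [exact: hbox_lb xab|exact/le_vec_cube/ltW].
  by move: gh; rewrite ltNge divr_ge0 // exprn_ge0 // ltW.
- apply: contrapT => nM; apply: nx; left; split=> // M.
  by apply: contrapT => MP; apply: nM; exists M.
- move=> r s r0 rs gr gs; apply: nx; right; exists (r, s) => //.
Qed.

(** By [weak_type] for each G N, the outer measure of the set is at most G N a b / q, which tends to
    0. *)
Lemma negligible_inf_derivative a b (G : nat -> 'rV[R]_n -> 'rV[R]_n -> R) q :
  (forall N, interval_fun a b (G N)) -> le_vec a b -> 0 < q ->
  (fun N => G N a b) @ \oo --> (0 : R) ->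
  negligible_vec [set x | hbox a b x /\ forall N,
    frequently0 (fun h => q * h ^+ n <= G N x (x + const_mx h))].
Proof.
move=> GI ab q0 G0 e e0; have e20 : 0 < e / 2 by rewrite divr_gt0.
have /cvgrPdist_le/(_ _ (mulr_gt0 e20 q0))[N _ /(_ N (leqnn N))] := G0.
rewrite sub0r normrN => GN.
set E := [set x | _]; apply: (covered_sub (Y := E) _ _
  (weak_type (GI N) ab q0 e20 _ _)) => //.
- rewrite [leRHS]splitr lerD2r ler_pdivrMr //.
  exact: le_trans (ler_norm _) GN.
- by move=> x [].
- by move=> x [_ /(_ N)].
Qed.

End Differentiation.

(** * Joint increments as additive box functions, and tails of the series *)

Section JointIncrement.
Variables (R : realType) (n : nat).
Implicit Types (a b c d x : 'rV[R]_n) (f : 'rV[R]_n -> R).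

Definition corner c d (eps : {ffun 'I_n -> bool}) : 'rV[R]_n :=
  \row_j (c 0 j + (eps j)%:R * (d 0 j - c 0 j)).

Lemma corner_box a b c d eps : le_vec a c -> le_vec c d -> le_vec d b ->
  box a b (corner c d eps).
Proof.
by move=> ac cd db; split=> j; rewrite mxE; case: (eps j);
  move: (ac j) (cd j) (db j); rewrite ?mul1r ?mul0r; lra.
Qed.

(** The corners on the cutting hyperplane occur in both halves with opposite signs and cancel; the
    others are the corners of [c, d]. *)
Lemma joint_increment_cut f c d j t : joint_increment f c d =
  joint_increment f c (upd d j t) + joint_increment f (upd c j t) d.
Proof.
pose flip (e : {ffun 'I_n -> bool}) := [ffun i => if i == j then ~~ e i else e i].
have flipK : involutive flip.
  by move=> e; apply/ffunP => i; rewrite !ffunE; case: eqP; rewrite ?negbK.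
have sgn_flip e : (-1) ^+ (n + \sum_(i < n) flip e i)%N =
    - (-1) ^+ (n + \sum_(i < n) e i)%N :> R.
  rewrite !exprD -mulrN; congr (_ * _).
  rewrite (bigD1 j) //= [in RHS](bigD1 j) //= !exprD ffunE eqxx -mulNr.
  congr (_ * _); first by case: (e j); rewrite ?expr0 ?expr1 ?opprK.
  by congr (_ ^+ _); apply: eq_bigr => i /negPf ij; rewrite ffunE ij.
rewrite /joint_increment (bigID (fun e : {ffun 'I_n -> bool} => e j)) /=.
rewrite [X in _ = X + _](bigID (fun e : {ffun 'I_n -> bool} => e j)) /=.
rewrite [X in _ = _ + X](bigID (fun e : {ffun 'I_n -> bool} => e j)) /=.
set A1 := (X in X + _ = _); set A0 := (X in _ + X = _).
set B1 := (X in _ = X + _ + _); set B0 := (X in _ = _ + X + _).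
set C1 := (X in _ = _ + (X + _)); set C0 := (X in _ = _ + (_ + X)).
have -> : A1 = C1.
  apply: eq_bigr => e ej; congr (_ * f _); apply/rowP => i; rewrite !mxE.
  by case: eqP => // ->; rewrite ej /=; ring.
have -> : A0 = B0.
  apply: eq_bigr => e /negPf ej; congr (_ * f _); apply/rowP => i; rewrite !mxE.
  by case: eqP => // ->; rewrite ej /=; ring.
(* [B1] and [C0] collect the corners with j-th coordinate t, seen from the first and from the second
   half; [flip] matches them. *)
suff -> : B1 = - C0 by ring.
rewrite /B1 (reindex_inj (inv_inj flipK)) -sumrN /=.
apply: eq_big => [e|e]; first by rewrite ffunE eqxx.
rewrite ffunE eqxx => /negPf ej; rewrite sgn_flip mulNr; congr (- (_ * f _)).
apply/rowP => i; rewrite !mxE ffunE; case: eqP => // ->.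
by rewrite ej /=; ring.
Qed.

Lemma cvg_sum_ord (I : Type) (r : seq I) (T : Type) (H : set_system T)
    (u : I -> T -> R) (l : I -> R) : Filter H ->
  (forall i, u i t @[t --> H] --> l i) ->
  \sum_(i <- r) u i t @[t --> H] --> \sum_(i <- r) l i.
Proof. by move=> FH ul; apply: cvg_big => //; exact: add_continuous. Qed.

Section Series.
Variables (a b : 'rV[R]_n) (f : nat -> 'rV[R]_n -> R).
Hypothesis f_mono : forall i, jointly_monotone a b (f i).
Hypothesis f_cvg : forall x, box a b x -> cvgn (series (fun i => f i x)).

Lemma joint_increment_sum_fun c d : le_vec a c -> le_vec c d -> le_vec d b ->
  series (fun i => joint_increment (f i) c d) @ \oo -->
    joint_increment (sum_fun f) c d.
Proof.
move=> ac cd db; rewrite /joint_increment.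
have -> : series (fun i => joint_increment (f i) c d) = (fun N =>
    \sum_(eps : {ffun 'I_n -> bool}) (-1) ^+ (n + \sum_(j < n) eps j)%N *
      series (fun i => f i (corner c d eps)) N).
  apply/funext => N; rewrite /series /= exchange_big /=.
  by apply: eq_bigr => eps _; rewrite mulr_sumr.
apply: cvg_sum_ord => eps; apply: cvgM; first exact: cvg_cst.
exact/f_cvg/corner_box.
Qed.

Definition joint_tail N c d :=
  joint_increment (sum_fun f) c d - \sum_(i < N) joint_increment (f i) c d.

Lemma joint_increment_ge0 i c d : le_vec a c -> le_vec c d -> le_vec d b ->
  0 <= joint_increment (f i) c d.
Proof.
move=> ac cd db; apply: f_mono => //; split=> //.
  exact: le_vec_trans cd db.
exact: le_vec_trans ac cd.
Qed.

Lemma interval_fun_joint_increment i : interval_fun a b (joint_increment (f i)).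
Proof.
split=> [c d|c d j t _ _ _ _]; first exact: joint_increment_ge0.
exact: joint_increment_cut.
Qed.

(** The partial sums of the nonnegative increments increase to the increment of the sum, so the tail
    is nonnegative; additivity follows by linearity. *)
Lemma interval_fun_joint_tail N : interval_fun a b (joint_tail N).
Proof.
split=> [c d ac cd db|c d j t _ _ _ _].
  have sum_cvg := joint_increment_sum_fun ac cd db.
  rewrite subr_ge0 -(cvg_lim (@Rhausdorff R) sum_cvg).
  have -> : \sum_(i < N) joint_increment (f i) c d =
      series (fun i => joint_increment (f i) c d) N by rewrite seriesEord.
  apply: nondecreasing_cvgn_le; last by apply/cvg_ex; eexists; exact: sum_cvg.
  by apply/nondecreasing_seqP => i; rewrite seriesSr lerDl joint_increment_ge0.
rewrite /joint_tail (joint_increment_cut _ c d j t).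
rewrite (eq_bigr (fun i : 'I_N => joint_increment (f i) c (upd d j t) +
  joint_increment (f i) (upd c j t) d)) ?big_split /=; first by ring.
by move=> i _; exact: joint_increment_cut.
Qed.

Lemma joint_tail_cvg0 : le_vec a b -> (fun N => joint_tail N a b) @ \oo --> (0 : R).
Proof.
move=> ab; rewrite -[0 : R](subrr (joint_increment (sum_fun f) a b)).
apply: cvgB; first exact: cvg_cst.
have := @joint_increment_sum_fun a b (fun=> lexx _) ab (fun=> lexx _).
by rewrite seriesEord.
Qed.

End Series.

End JointIncrement.

(** * Boundary faces, outer measure zero and interior points *)

Section NullSets.
Variables (R : realType) (n : nat) (n_gt0 : (0 < n)%N).
Implicit Types (a b x : 'rV[R]_n) (X : set 'rV[R]_n).

(** The face lies in a slab of thickness e / K, with K the product of the other sides. Raising b by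
    1 puts the points with x_i = b_i in the half-open box and keeps K > 0 even if some a_i = b_i. *)
Lemma negligible_vec_face a b (j : 'I_n) t : le_vec a b ->
  negligible_vec [set x | box a b x /\ x 0 j = t].
Proof.
move=> ab e e0.
pose K := \prod_(i < n | i != j) (b 0 i + 1 - a 0 i).
have K0 : 0 < K by apply: prodr_gt0 => i _; move: (ab i); lra.
have eK0 : 0 < e / K by rewrite divr_gt0.
pose l := (upd a j t, upd (b + const_mx 1) j (t + e / K)).
have -> : e = \sum_(l <- [:: l]) box_volume l.1 l.2.
  rewrite big_seq1 /box_volume (bigD1 j) //= !mxE eqxx.
  rewrite (eq_bigr (fun i => b 0 i + 1 - a 0 i)) => [|i /negPf ij].
    by rewrite -/K; field; rewrite gt_eqF.
  by rewrite !mxE ij.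
apply: covered_sub (lexx _) (covered_seq n_gt0 _).
  move=> x [[ax xb] xt] /=; rewrite orbF; apply/hboxP => i; rewrite !mxE.
  by case: eqP => [->|_]; move: (ax i) (xb i); rewrite ?xt; lra.
move=> _ /[!inE]/eqP -> i; rewrite !mxE.
by case: eqP => _; move: (ab i); lra.
Qed.

(** Closing the half-open boxes keeps their volumes, so the infimum is at most every e > 0. *)
Lemma negligible_vec_outer_measure X : negligible_vec X ->
  lebesgue_outer_measure X = 0%E.
Proof.
move=> X0; apply/eqP; rewrite eq_le; apply/andP; split.
  apply/lee_addgt0Pr => e e0; rewrite add0e.
  have [C [Cle XC Cv]] := X0 _ e0.
  apply: (@le_trans _ _ (\sum_(0 <= k <oo) (box_volume (C k).1 (C k).2)%:E)%E).
    apply: ereal_inf_lbound; exists C => //; split=> // x /XC[k /hboxP xk].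
    by exists k => //; split=> j; case/andP: (xk j) => // _ /ltW.
  apply: lime_le.
    by apply: is_cvg_nneseries => k _ _; rewrite lee_fin box_volume_ge0.
  apply: nearW => N; rewrite sumEFin lee_fin big_mkord.
  exact: Cv.
apply: le_ereal_inf_tmp => _ [C [Cle _] <-].
by apply: nneseries_ge0 => k _ _; rewrite lee_fin box_volume_ge0.
Qed.

Lemma interior_box a b x : (forall j, a 0 j < x 0 j < b 0 j) ->
  interior (box a b) x.
Proof.
move=> xab; apply/nbhs_ballP.
pose e := \big[Num.min/1]_(j < n) Num.min (x 0 j - a 0 j) (b 0 j - x 0 j).
have e0 : 0 < e.
  apply/bigmin_gtP; split=> // j _; rewrite lt_min !subr_gt0.
  exact: xab.
exists e => // y [_ xy].
have ey j : `|x 0 j - y 0 j| < Num.min (x 0 j - a 0 j) (b 0 j - x 0 j).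
  by apply: lt_le_trans (xy 0 j) _; exact: bigmin_le.
by split=> j; move: (ey j); rewrite lt_min !ltr_norml; lra.
Qed.

End NullSets.

(** * Termwise joint differentiation of the series *)

Theorem theorem1p7 (R : realType) (n : nat) (hn : (1 <= n)%N)
    (a b : 'rV[R]_n) (hab : forall j : 'I_n, a 0 j < b 0 j)
    (f : nat -> 'rV[R]_n -> R)
    (hf : forall i : nat, jointly_monotone a b (f i))
    (hcvg : forall x : 'rV[R]_n, box a b x -> cvgn (series (fun i => f i x))) :
  ae_in (box a b) (fun x : 'rV[R]_n =>
    [/\ joint_derivable (box a b) (sum_fun f) x,
        forall i : nat, joint_derivable (box a b) (f i) x,
        cvgn (series (fun i => joint_derivative (f i) x)) &
        joint_derivative (sum_fun f) x
          = limn (series (fun i => joint_derivative (f i) x))]).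
Proof.
have ab : le_vec a b by move=> j; apply: ltW.
pose F := joint_increment (sum_fun f).
have tailI := interval_fun_joint_tail hf hcvg.
have FI : interval_fun a b F.
  have -> : F = joint_tail f 0; last exact: tailI.
  by apply/funext => c; apply/funext => d; rewrite /joint_tail big_ord0 subr0.
(* The exceptional sets: the faces of [a, b]; the points where the quotient of the sum or of a term
   has no limit; for each k, the points where every tail has quotients at least 1 / (k + 1) for
   arbitrarily small h. *)
pose Zface (js : 'I_n * bool) := [set x : 'rV[R]_n | box a b x /\
  x 0 js.1 = if js.2 then a 0 js.1 else b 0 js.1].
pose Zlim (G : 'rV[R]_n -> 'rV[R]_n -> R) := [set x | hbox a b x /\
  ~ cvg (G x (x + const_mx h) / h ^+ n @[h --> 0^'+])].
pose Ztail (k : nat) := [set x | hbox a b x /\ forall N, frequently0 (fun h =>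
  k.+1%:R^-1 * h ^+ n <= joint_tail f N x (x + const_mx h))].
have Z0 : negligible_vec ((\bigcup_js Zface js `|` Zlim F) `|`
    (\bigcup_i Zlim (joint_increment (f i)) `|` \bigcup_k Ztail k)).
  apply: negligible_vecU => //; apply: negligible_vecU => //.
  - by apply: negligible_vec_countable => // js; apply: negligible_vec_face.
  - exact: ae_quotient_cvg FI ab.
  - apply: negligible_vec_bigcup => // i.
    exact: ae_quotient_cvg (interval_fun_joint_increment hf i) ab.
  - apply: negligible_vec_bigcup => // k.
    apply: (negligible_inf_derivative hn tailI ab _ (joint_tail_cvg0 hcvg ab)).
    by rewrite invr_gt0.
apply: negligible_vec_outer_measure; apply: negligible_vec_sub Z0.
move=> x [xab bad]; apply: contrapT => nZ; apply: bad.
have xint j : a 0 j < x 0 j < b 0 j.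
  have [/(_ j) ax /(_ j) xb] := xab.
  rewrite !lt_neqAle ax xb !andbT; apply/andP; split; apply/eqP => E; apply: nZ;
    left; left.
  - by exists (j, true) => //; split.
  - by exists (j, false) => //; split.
have xh : hbox a b x by apply/hboxP => j; case/andP: (xint j) => /ltW -> ->.
have xi : interior (box a b) x by exact: interior_box.
have Fcvg : cvg (joint_quotient (sum_fun f) x h @[h --> 0^'+]).
  by apply: contrapT => nc; apply: nZ; left; right.
have fcvg i : cvg (joint_quotient (f i) x h @[h --> 0^'+]).
  by apply: contrapT => nc; apply: nZ; right; left; exists i.
have tail_near N : \forall h \near 0^'+,
    0 <= joint_tail f N x (x + const_mx h) / h ^+ n.
  have [e e0 eb] := small_cube_inside xh.
  near=> h; have h0 : 0 < h by near: h; exact: nbhs_right_gt.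
  rewrite divr_ge0 ?exprn_ge0 ?(ltW h0) //; apply: (tailI N).1.
  - exact: hbox_lb xh.
  - exact/le_vec_cube/ltW.
  - by apply: eb; near: h; exact: nbhs_right_lt.
have f_near i : \forall h \near 0^'+, 0 <= joint_quotient (f i) x h.
  have [e e0 eb] := small_cube_inside xh.
  near=> h; have h0 : 0 < h by near: h; exact: nbhs_right_gt.
  rewrite divr_ge0 ?exprn_ge0 ?(ltW h0) //; apply: (joint_increment_ge0 hf).
  - exact: hbox_lb xh.
  - exact/le_vec_cube/ltW.
  - by apply: eb; near: h; exact: nbhs_right_lt.
pose D := joint_derivative (sum_fun f) x.
pose Df i := joint_derivative (f i) x.
(* By linearity the N-th tail has derivative D minus the N-th partial sum; its sign then bounds the
   partial sums by D. *)
have tail_cvg N : joint_tail f N x (x + const_mx h) / h ^+ n @[h --> 0^'+] -->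
    D - series Df N.
  rewrite seriesEord /=.
  have -> : (fun h => joint_tail f N x (x + const_mx h) / h ^+ n) = (fun h =>
      joint_quotient (sum_fun f) x h - \sum_(i < N) joint_quotient (f i) x h).
    by apply/funext => h; rewrite /joint_quotient -mulr_suml -mulrBl.
  apply: cvgB; first exact: Fcvg.
  by apply: cvg_sum_ord => i; exact: fcvg.
have D_ge N : series Df N <= D.
  by rewrite -subr_ge0; apply: cvgr_to_ge (tail_cvg N) (tail_near N).
have Df0 i : 0 <= Df i by apply: limr_ge (fcvg i) (f_near i).
have series_cvg : series Df @ \oo --> D.
  apply/cvgrPdist_le => e e0.
  have [k ke] : exists k : nat, k.+1%:R^-1 < e.
    by have /cvgrPdist_lt/(_ _ e0)[k _ /(_ k (leqnn k))] := @cvg_harmonic R;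
      rewrite sub0r normrN /= ger0_norm ?invr_ge0 //; exists k.
  (* Since x is outside [Ztail k], some tail has quotients below 1 / (k + 1) for all small h. *)
  have [N nfreq] : exists N, ~ frequently0 (fun h =>
      k.+1%:R^-1 * h ^+ n <= joint_tail f N x (x + const_mx h)).
    apply: contrapT => nN; apply: nZ; right; right; exists k => //; split=> // N.
    by apply: contrapT => nf; apply: nN; exists N.
  have DN : D - series Df N <= k.+1%:R^-1.
    apply: cvgr_to_le (tail_cvg N) _; have nk := not_frequently0 nfreq.
    near=> h; have h0 : 0 < h by near: h; exact: nbhs_right_gt.
    rewrite ler_pdivrMr ?exprn_gt0 // leNgt; apply/negP => /ltW.
    by near: h.
  exists N => // M /= NM.
  have SNM : series Df N <= series Df M.
    have : nondecreasing_seq (series Df); last exact.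
    by apply/nondecreasing_seqP => i; rewrite seriesSr lerDl.
  rewrite ger0_norm ?subr_ge0 //; apply: le_trans (ltW ke).
  by apply: le_trans DN; rewrite lerB.
split=> //.
- by apply/cvg_ex; exists D.
- by rewrite -/D; apply/esym/(cvg_lim (@Rhausdorff R)).
Unshelve. all: by end_near. Qed.
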